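(* (i) Suppose $\Vert\mathcal{A}\bm{x}^\star\Vert\neq0$ and $\Vert\bm{\lambda}^\star\Vert=0$. Let $\bm{\zeta}^0\neq\bm{0}$ be any initialization, let $$\omega_1=\arccos\frac{\langle\mathcal{A}\bm{x}^\star,\bm{\zeta}^0\rangle}{\Vert\mathcal{A}\bm{x}^\star\Vert\,\Vert\bm{\zeta}^0\Vert},$$ with $\cos\omega_1\neq0$, and choose the step-size $\rho=\rho^\star_{\mathrm{pri}}=\frac{\Vert\bm{\zeta}^0\Vert}{\Vert\mathcal{A}\bm{x}^\star\Vert}\frac{1}{\cos\omega_1}$. Then the ADMM iterates satisfy, for all $k=0,1,2,\dots$, $$\Vert\mathcal{A}\bm{x}^{k+2}-\mathcal{A}\bm{x}^{k+1}\Vert^2\le\frac{1}{k+1}\Vert\mathcal{A}\bm{x}^\star\Vert^2\sin^2\omega_1,$$ $$\Vert\bm{\lambda}^{k+1}-\bm{\lambda}^k\Vert^2\le\frac{1}{k+1}\cdot\frac{\Vert\bm{\zeta}^0\Vert^4}{\Vert\mathcal{A}\bm{x}^\star\Vert^2}\cdot\frac{\tan^2\omega_1}{\cos^2\omega_1},$$ $$\Vert\bm{\zeta}^{k+1}-\bm{\zeta}^k\Vert^2\le\frac{1}{k+1}\Vert\bm{\zeta}^0\Vert^2\tan^2\omega_1 .$$ (ii) Suppose $\Vert\mathcal{A}\bm{x}^\star\Vert=0$ and $\Vert\bm{\lambda}^\star\Vert\neq0$. Let $\bm{\zeta}^0\neq\bm{0}$ be any initialization, let $$\omega_2=\arccos\frac{\langle\bm{\lambda}^\star,\bm{\zeta}^0\rangle}{\Vert\bm{\lambda}^\star\Vert\,\Vert\bm{\zeta}^0\Vert},$$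 with $\cos\omega_2\neq0$, and choose the step-size $\rho=\rho^\star_{\mathrm{dual}}=1\big/\big(\frac{\Vert\bm{\zeta}^0\Vert}{\Vert\bm{\lambda}^\star\Vert}\frac{1}{\cos\omega_2}\big)$. Then the ADMM iterates satisfy, for all $k=0,1,2,\dots$, $$\Vert\bm{\lambda}^{k+1}-\bm{\lambda}^k\Vert^2\le\frac{1}{k+1}\Vert\bm{\lambda}^\star\Vert^2\sin^2\omega_2,$$ $$\Vert\mathcal{A}\bm{x}^{k+2}-\mathcal{A}\bm{x}^{k+1}\Vert^2\le\frac{1}{k+1}\cdot\frac{\Vert\bm{\zeta}^0\Vert^4}{\Vert\bm{\lambda}^\star\Vert^2}\cdot\frac{\tan^2\omega_2}{\cos^2\omega_2},$$ $$\Vert\bm{\zeta}^{k+1}-\bm{\zeta}^k\Vert^2\le\frac{1}{k+1}\Vert\bm{\zeta}^0\Vert^2\tan^2\omega_2 .$$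
   Context: $\mathbb{H},\mathbb{P},\mathbb{K}$ are real Hilbert spaces; $\Gamma_0(\cdot)$ denotes convex, closed, proper functions with values in $(-\infty,+\infty]$. Consider: minimize $f(\bm{x})+g(\bm{z})$ subject to $\mathcal{A}\bm{x}-\mathcal{B}\bm{z}=\bm{c}$, with $f\in\Gamma_0(\mathbb{H})$, $g\in\Gamma_0(\mathbb{P})$, $\bm{c}\in\mathbb{K}$, and $\mathcal{A}:\mathbb{H}\to\mathbb{K}$, $\mathcal{B}:\mathbb{P}\to\mathbb{K}$ injective bounded linear. A solution is assumed to exist: $\bm{x}^\star,\bm{z}^\star$ are optimal and $\bm{\lambda}^\star\in\mathbb{K}$ is an optimal Lagrange multiplier (i.e. $(\bm{x}^\star,\bm{z}^\star,\bm{\lambda}^\star)$ is a saddle point of $f(\bm{x})+g(\bm{z})+\langle\bm{\lambda},\mathcal{A}\bm{x}-\mathcal{B}\bm{z}-\bm{c}\rangle$). For a fixed domain step-size $\rho\neq0$ (classical step-size $\gamma=\rho^2$), ADMM iterates, for $k=0,1,\dots$: $$\bm{x}^{k+1}=\mathrm{argmin}_{\bm{x}}\,f(\bm{x})+\tfrac12\Vert\rho(\mathcal{A}\bm{x}-\mathcal{B}\bm{z}^k-\bm{c})+\bm{\lambda}^k/\rho\Vert^2,$$ $$\bm{z}^{k+1}=\mathrm{argmin}_{\bm{z}}\,g(\bm{z})+\tfrac12\Vert\rho(\mathcal{A}\bm{x}^{k+1}-\mathcal{B}\bm{z}-\bm{c})+\bm{\lambda}^k/\rho\Vert^2,$$ $$\bm{\lambda}^{k+1}=\bm{\lambda}^k+\rho^2(\mathcal{A}\bm{x}^{k+1}-\mathcal{B}\bm{z}^{k+1}-\bm{c}).$$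 All minimizers are understood to exist. The fixed-point variable is $\bm{\zeta}^{k+1}=\rho\mathcal{A}\bm{x}^{k+1}+\bm{\lambda}^k/\rho$, and the iteration is a fixed-point iteration in $\bm{\zeta}$. Initializing at $\bm{\zeta}^0\in\mathbb{K}$ means $\bm{z}^0=\mathrm{argmin}_{\bm{z}}\,g(\bm{z})+\frac12\Vert\rho\mathcal{B}\bm{z}+\rho\bm{c}-\bm{\zeta}^0\Vert^2$ and $\bm{\lambda}^0=\rho\bm{\zeta}^0-\rho^2(\mathcal{B}\bm{z}^0+\bm{c})$, the same relations that hold between $\bm{\zeta}^k$ and $(\bm{z}^k,\bm{\lambda}^k)$ for every $k\ge1$. *)

(* Defs.v *)
From HB Require Import structures.
From mathcomp Require Import all_boot all_order all_algebra.
From mathcomp Require Import all_classical all_reals all_analysis.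

Set Implicit Arguments.
Unset Strict Implicit.
Unset Printing Implicit Defensive.

Import Order.TTheory GRing.Theory Num.Theory.
Import numFieldNormedType.Exports.

Local Open Scope classical_set_scope.
Local Open Scope ring_scope.

(* A real Hilbert space: a complete normed space whose norm is induced by a
   symmetric positive definite bilinear form. *)
HB.mixin Record isHilbert (R : realType) H of CompleteNormedModule R H := {
  inner : {dot H for (@idfun R)} ;
  normr_inner : forall x : H, `|x| ^+ 2 = inner x x
}.

#[short(type="hilbertType")]
HB.structure Definition Hilbert (R : realType) :=
  {H of isHilbert R H & CompleteNormedModule R H}.

Section ConvexFunctions.
Context {R : realType} {H : hilbertType R}.
Implicit Types f : H -> \bar R.
Local Open Scope ereal_scope.

Definition epigraph f : set (H * R) := [set p | f p.1 <= p.2%:E].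

(* The library's [convex_function] is for real-valued functions.  For a proper
   [f] no indeterminate sum occurs below, and [0 * +oo = 0] makes the cases
   [t = 0] and [t = 1] trivial. *)
Definition ereal_convex f := forall (x y : H) (t : R), (0 <= t <= 1)%R ->
  f (t *: x + (1 - t) *: y)%R <= t%:E * f x + (1 - t)%:E * f y.

Definition ereal_proper f := (forall x, f x != -oo) /\ (exists x, f x < +oo).

Definition Gamma0 f := [/\ ereal_convex f, closed (epigraph f) & ereal_proper f].

Definition is_argmin f (x : H) := forall y, f x <= f y.

End ConvexFunctions.

Section Angle.
Context {R : realType} {H : hilbertType R}.

Definition angle (u v : H) : R := acos (inner u v / (`|u| * `|v|)).

End Angle.

Section ADMM.
Context {R : realType} {H P K : hilbertType R}.
Variables (f : H -> \bar R) (g : P -> \bar R).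
Variables (A : {linear H -> K}) (B : {linear P -> K}) (c : K).
Local Open Scope ereal_scope.

Definition lagrangian (x : H) (z : P) (l : K) : \bar R :=
  f x + g z + (inner l (A x - B z - c)%R)%:E.

Definition is_optimal (xs : H) (zs : P) :=
  (A xs - B zs = c)%R /\
  forall x z, (A x - B z = c)%R -> f xs + g zs <= f x + g z.

Definition is_saddle_point (xs : H) (zs : P) (ls : K) :=
  (forall l, lagrangian xs zs l <= lagrangian xs zs ls) /\
  (forall x z, lagrangian xs zs ls <= lagrangian x z ls).

(* The algorithm produces x only from index 1 on, so [x 0] is unconstrained.
   Since A and B are injective, each minimizer is unique, and [is_argmin]
   pins the iterates down. *)
Record admm_iterates (rho : R) (zeta0 : K)
    (x : nat -> H) (z : nat -> P) (lambda zeta : nat -> K) : Prop := {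
  admm_zeta_init : zeta 0%N = zeta0 ;
  admm_z_init :
    is_argmin (fun v : P =>
      g v + (2^-1 * `|rho *: B v + rho *: c - zeta0| ^+ 2)%:E) (z 0%N) ;
  admm_lambda_init :
    lambda 0%N = (rho *: zeta0 - rho ^+ 2 *: (B (z 0%N) + c))%R ;
  admm_x : forall k,
    is_argmin (fun u : H =>
      f u + (2^-1 * `|rho *: (A u - B (z k) - c) + rho^-1 *: lambda k| ^+ 2)%:E)
      (x k.+1) ;
  admm_z : forall k,
    is_argmin (fun v : P =>
      g v + (2^-1 *
        `|rho *: (A (x k.+1) - B v - c) + rho^-1 *: lambda k| ^+ 2)%:E)
      (z k.+1) ;
  admm_lambda : forall k,
    lambda k.+1 =
    (lambda k + rho ^+ 2 *: (A (x k.+1) - B (z k.+1) - c))%R ;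
  admm_zeta : forall k,
    zeta k.+1 = (rho *: A (x k.+1) + rho^-1 *: lambda k)%R
}.

End ADMM.

(* Main.v *)
(** In the variable [zeta] an ADMM iteration is a Douglas-Rachford step, which
    is firmly nonexpansive and fixes [zetas = rho A xs + ls / rho].  Summing
    [|zeta (k+1) - zetas|^2 + |zeta (k+1) - zeta k|^2 <= |zeta k - zetas|^2],
    whose increments decrease, bounds the squared increment by
    [|zeta0 - zetas|^2 / (k + 1)]; the increments of [rho A x] and
    [lambda / rho] are dominated by that of [zeta].  In either case the chosen
    step-size places [zetas], a multiple of [A xs] or of [ls], so that
    [zeta0 - zetas] is orthogonal to [zeta0], hence at distance
    [|zeta0| |tan omega|] from it. *)

Require Import Defs.
From HB Require Import structures.
From mathcomp Require Import all_boot all_order all_algebra.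
From mathcomp Require Import all_classical all_reals all_analysis.
From mathcomp Require Import ring lra.
Import Order.TTheory GRing.Theory Num.Theory.
Import numFieldNormedType.Exports.
Local Open Scope classical_set_scope.
Local Open Scope ring_scope.

(** * Inner product identities, Cauchy-Schwarz and angles *)

Section InnerProduct.
Context {R : realType} {K : hilbertType R}.
Implicit Types (u v w : K) (r : R).

Lemma innerC u v : inner u v = inner v u.
Proof. by rewrite hermC /= expr0 mul1r. Qed.

Lemma innerDl u v w : inner (u + v) w = inner u w + inner v w.
Proof. exact: linearDl. Qed.

Lemma innerDr u v w : inner w (u + v) = inner w u + inner w v.
Proof. exact: linearDr. Qed.

Lemma innerNl u w : inner (- u) w = - inner u w.
Proof. exact: linearNl. Qed.

Lemma innerNr u w : inner w (- u) = - inner w u.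
Proof. exact: linearNr. Qed.

Lemma innerZl r u w : inner (r *: u) w = r * inner u w.
Proof. exact: linearZl_LR. Qed.

Lemma innerZr r u w : inner w (r *: u) = r * inner w u.
Proof. by rewrite innerC innerZl innerC. Qed.

Definition innerE := (innerDl, innerDr, innerNl, innerNr, innerZl, innerZr).

Lemma inner_ge0 u : 0 <= inner u u.
Proof. by rewrite -normr_inner exprn_ge0. Qed.

Lemma sqrnormB u v : `|u - v| ^+ 2 = `|u| ^+ 2 - 2 * inner u v + `|v| ^+ 2.
Proof. by rewrite !normr_inner !innerE (innerC v u); ring. Qed.

(** Cauchy-Schwarz: expand the squared distance from [u / |u|] to [s v / |v|] for [s = 1] and
    [s = -1]. *)
Lemma inner_normalized_le1 u v : u != 0 -> v != 0 ->
  `|inner u v / (`|u| * `|v|)| <= 1.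
Proof.
move=> u0 v0; have nu : `|u| != 0 by rewrite normr_eq0.
have nv : `|v| != 0 by rewrite normr_eq0.
have key (s : R) : s ^+ 2 = 1 -> 0 <= 2 * (1 - s * (inner u v / (`|u| * `|v|))).
  move=> s1; have := exprn_ge0 2 (normr_ge0 (`|u|^-1 *: u - (s * `|v|^-1) *: v)).
  rewrite sqrnormB !normr_inner !innerE -!normr_inner.
  suff -> : `|u|^-1 * (`|u|^-1 * `|u| ^+ 2) -
      2 * (s * `|v|^-1 * (`|u|^-1 * inner u v)) +
      s * `|v|^-1 * (s * `|v|^-1 * `|v| ^+ 2)
    = 2 * (1 - s * (inner u v / (`|u| * `|v|))) + (s ^+ 2 - 1).
    by rewrite s1 subrr addr0.
  by field; rewrite nu nv.
have := key 1 (expr1n _ _); have := key (- 1) (etrans (sqrrN _) (expr1n _ _)).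
by rewrite ler_norml => ? ?; apply/andP; split; lra.
Qed.

Lemma cos_angle u v : u != 0 -> v != 0 ->
  cos (angle u v) = inner u v / (`|u| * `|v|).
Proof.
move=> u0 v0; apply: acosK; rewrite in_itv /= -ler_norml.
exact: inner_normalized_le1.
Qed.

(* The multiple of [u] below is the one for which [v - r u] is orthogonal
   to [v]. *)
Lemma sqrnormB_angle u v : u != 0 -> v != 0 -> cos (angle u v) != 0 ->
  `|v - (`|v| / `|u| * (1 / cos (angle u v))) *: u| ^+ 2
  = `|v| ^+ 2 * tan (angle u v) ^+ 2.
Proof.
move=> u0 v0 c0; have nu : `|u| != 0 by rewrite normr_eq0.
have nv : `|v| != 0 by rewrite normr_eq0.
have E : inner u v = cos (angle u v) * (`|u| * `|v|).
  by rewrite cos_angle// divfK// mulf_neq0.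
rewrite sqrnormB (normr_inner (_ *: _)) !innerE -normr_inner (innerC v) E /tan.
by rewrite exprMn exprVn sin2cos2; field; rewrite c0 nu.
Qed.

End InnerProduct.

(** * Subgradients along a linear map and first-order optimality *)

Section Subgradient.
Context {R : realType} {H K : hilbertType R}.
Implicit Types (h : H -> \bar R) (L : {linear H -> K}).

(* For bounded [L] this says that the adjoint of [L] maps [w] into the
   subdifferential of [h] at [x]; the adjoint itself is never needed. *)
Definition subgradient_along h L (w : K) (x : H) :=
  h x \is a fin_num /\
  forall u, (h x + (inner w (L u - L x))%:E <= h u)%E.

(** Each subgradient inequality is tested at the other point, and the two are added. *)
Lemma subgradient_monotone h L (w w' : K) (x x' : H) :
  subgradient_along h L w x -> subgradient_along h L w' x' ->
  0 <= inner (w - w') (L x - L x').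
Proof.
move=> [fx hx] [fx' hx']; have := hx x'; have := hx' x.
rewrite -(fineK fx) -(fineK fx') -!EFinD !lee_fin !innerE; lra.
Qed.

Lemma ge0_of_quadratic (D Q : R) :
  (forall t, 0 < t -> t < 1 -> 0 <= t * D + t ^+ 2 * Q) -> 0 <= D.
Proof.
move=> DQ; rewrite leNgt; apply/negP => D0.
have Q0 := normr_ge0 Q; have QQ := ler_norm Q.
have d0 : 0 < `|Q| - D + 1 by lra.
(* If [D < 0], this [t] gives [D + t |Q| = t (D - 1) < 0], contradicting the hypothesis divided by
   [t]. *)
pose t := - D / (`|Q| - D + 1).
have t0 : 0 < t by rewrite divr_gt0//; lra.
have tE : t * (`|Q| - D + 1) = - D by rewrite /t divfK// gt_eqF.
have t1 : t < 1 by rewrite /t ltr_pdivrMr//; lra.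
have := DQ t t0 t1; rewrite expr2 -mulrA -mulrDr pmulr_rge0//.
have tQ : t * Q <= t * `|Q| by rewrite ler_pM2l.
have : t * D > - D * (- 1) by nra.
nra.
Qed.

Lemma argmin_fin_num h (q : H -> R) (x : H) : ereal_proper h ->
  is_argmin (fun u => h u + (q u)%:E)%E x -> h x \is a fin_num.
Proof.
move=> [hN [u hu]] /(_ u) hx; rewrite fin_numE hN /=.
apply/eqP => hxy; move: hx; rewrite hxy /= addye// leye_eq => /eqP.
by case: (h u) hu => //= r _.
Qed.

(** Fermat's rule without differentiation: [x] is compared with points of the segment towards [u].
    Convexity bounds [h] there, and the penalty leaves a linear term in [t] plus a quadratic
    remainder. *)
Lemma argmin_subgradient h L (rho : R) (b : K) (x : H) :
  ereal_convex h -> ereal_proper h ->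
  is_argmin (fun u => h u + (2^-1 * `|rho *: L u - b| ^+ 2)%:E)%E x ->
  subgradient_along h L (rho *: (b - rho *: L x)) x.
Proof.
move=> hc hp hx; have fx := argmin_fin_num _ _ _ hp hx; split=> // u.
have [hN _] := hp.
case hu : (h u) => [r| |]; last by have := hN u; rewrite hu.
  2: by rewrite leey.
move: hx; rewrite -(fineK fx); set s := fine _ => hx.
rewrite -EFinD lee_fin.
suff : 0 <= r - (s + inner (rho *: (b - rho *: L x)) (L u - L x)) by lra.
apply: (ge0_of_quadratic _ (2^-1 * `|rho *: (L u - L x)| ^+ 2)) => t t0 t1.
have := le_trans (hx (t *: u + (1 - t) *: x)) (leeD2r _ (hc u x t _)).
rewrite -(fineK fx) -/s hu -!EFinM -!EFinD lee_fin => /(_ _).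
have -> : L (t *: u + (1 - t) *: x) = L x + t *: (L u - L x).
  by rewrite linearD !linearZ /= scalerBl scale1r scalerBr addrCA addrA.
set d := L u - L x; set y := L x => key.
have {key} := key _; rewrite (ltW t0) (ltW t1) => /(_ isT).
clearbody d y; rewrite !normr_inner !innerE (innerC y d) (innerC b d) (innerC b y).
lra.
Qed.

End Subgradient.

(** * Firm nonexpansiveness of one step, and the rate it implies *)

Section DouglasRachfordStep.
Context {R : realType} {K : hilbertType R}.

(* [dp], [dl], [da] are the differences, between two runs, of the quantities
   [p = rho (B z + c)], [l = lambda / rho] and [a = rho A x]; one iteration
   sends [p + l] to [a + l]. *)
Lemma douglas_rachford_step (dp dl da : K) :
  0 <= inner (dp - dl - da) da -> 0 <= inner dl dp ->
  [/\ `|da + dl| ^+ 2 + `|da - dp| ^+ 2 <= `|dp + dl| ^+ 2,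
      `|da| ^+ 2 <= `|dp + dl| ^+ 2 & `|dl| ^+ 2 <= `|dp + dl| ^+ 2].
Proof.
(* The first bound is twice the sum of [Ha] and [Hl]. For the second, [|da| <= |dp - dl|] by [Ha]
   and the square of [dp - dl - da], then [Hl] gives [|dp - dl| <= |dp + dl|]. The third drops
   [|dp|^2]. *)
move=> Ha Hl; have := inner_ge0 (dp - dl - da); have := inner_ge0 dp.
move: Ha Hl; rewrite !normr_inner !innerE (innerC dp da) (innerC dl da).
by rewrite (innerC dp dl) => Ha Hl H1 H2; split; lra.
Qed.

End DouglasRachfordStep.

Lemma telescoped_rate {R : realType} (d e : nat -> R) :
  (forall k, 0 <= d k) -> (forall k, d k.+1 + e k <= d k) ->
  (forall k, e k.+1 <= e k) -> forall k, e k <= 1 / k.+1%:R * d 0%N.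
Proof.
move=> d0 de ee k; rewrite mul1r mulrC ler_pdivlMr ?ltr0Sn//.
(* Telescoping in invariant form: as [e] decreases, [e k] may replace each of the [k + 1] terms
   summed so far. *)
suff : d k.+1 + e k * k.+1%:R <= d 0%N by have := d0 k.+1; lra.
elim: k => [|k IH]; first by rewrite mulr1.
apply: le_trans IH; have := de k.+1.
have : e k.+1 * k.+1%:R <= e k * k.+1%:R by rewrite ler_wpM2r.
by rewrite -[k.+2%:R]natr1; lra.
Qed.

(** * Optimality conditions of the iterates and the resulting rates *)

Section ADMM.
Context {R : realType} {H P K : hilbertType R}.
Variables (f : H -> \bar R) (g : P -> \bar R).
Variables (A : {linear H -> K}) (B : {linear P -> K}) (c : K).
Variables (xs : H) (zs : P) (ls : K).

(** Minimality of the Lagrangian at [ls] is restricted to one variable at a time; the opposite signs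
    come from [A x - B z]. *)
Lemma saddle_subgradients : ereal_proper f -> ereal_proper g ->
  is_saddle_point f g A B c xs zs ls ->
  subgradient_along f A (- ls) xs /\ subgradient_along g B ls zs.
Proof.
move=> [fN [u fu]] [gN [v gv]] [_ hs].
(* Comparison with a point where [f] and [g] are both finite rules out [+oo]. *)
have /andP[fx gz] : (f xs \is a fin_num) && (g zs \is a fin_num).
  have := hs u v; rewrite /lagrangian !fin_numE !fN !gN /=.
  move: (fN u) (gN v) (fN xs) (gN zs) fu gv.
  by case: (f u) (g v) (f xs) (g zs) => [?||] // [?||] // [?||] // [?||].
have hs' x z : (f xs + g zs <= f x + g z +
    (inner ls (A x - A xs) - inner ls (B z - B zs))%:E)%E.
  have := hs x z; rewrite /lagrangian -(fineK fx) -(fineK gz).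
  move: (fN x) (gN z); case: (f x) (g z) => [s||] // [t||] // _ _;
    rewrite ?(addey, addye, leey)//.
  by rewrite -!EFinD !lee_fin !innerE; lra.
split; split=> //.
  move=> x; have := hs' x zs; rewrite -(fineK fx) -(fineK gz).
  move: (fN x); case: (f x) => [s||] // _; last by rewrite !leey.
  by rewrite -!EFinD !lee_fin !innerE; lra.
move=> z; have := hs' xs z; rewrite -(fineK fx) -(fineK gz).
move: (gN z); case: (g z) => [s||] // _; last by rewrite !leey.
by rewrite -!EFinD !lee_fin !innerE; lra.
Qed.

Variables (rho : R) (zeta0 : K).
Variables (x : nat -> H) (z : nat -> P) (lambda zeta : nat -> K).
Hypotheses (hf : Gamma0 f) (hg : Gamma0 g) (rho0 : rho != 0).
Hypothesis hopt : is_optimal f g A B c xs zs.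
Hypothesis hsaddle : is_saddle_point f g A B c xs zs ls.
Hypothesis hadmm : admm_iterates f g A B c rho zeta0 x z lambda zeta.

(** The index shift in [a] makes iteration [k] send [p k + l k] to [a k + l k]. *)
Let p k := rho *: (B (z k) + c).
Let l k := rho^-1 *: lambda k.
Let a k := rho *: A (x k.+1).

Lemma admm_zetaE k : zeta k = p k + l k.
Proof.
case: k => [|k]; rewrite /p /l.
  rewrite (admm_zeta_init hadmm) (admm_lambda_init hadmm) scalerBr !scalerA.
  by rewrite expr2 mulKf// mulVf// scale1r addrC subrK.
rewrite (admm_zeta hadmm) (admm_lambda hadmm).
rewrite [rho^-1 *: (_ + _)]scalerDr scalerA expr2 mulKf// -addrA -opprD scalerBr.
by rewrite addrCA [rho *: (_ + _) + _]addrC subrK addrC.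
Qed.

(** By [admm_zetaE], the scaled residual of the [z]-minimization with [b = zeta k - rho c] is
    exactly [lambda k], at index 0 too. *)
Lemma admm_subgradient_z k : subgradient_along g B (lambda k) (z k).
Proof.
have [gc _ gp] := hg.
have -> : lambda k = rho *: ((zeta k - rho *: c) - rho *: B (z k)).
  rewrite admm_zetaE /p /l [rho *: (B _ + _)]scalerDr -addrA -opprD [rho *: c + _]addrC addrC addKr.
  by rewrite scalerA mulfV// scale1r.
apply: argmin_subgradient => // u.
case: k => [|k].
  have := admm_z_init hadmm u; rewrite (admm_zeta_init hadmm).
  by rewrite ![zeta0 - _]addrC !opprD !opprK !addrA.
have := admm_z hadmm k u; rewrite (admm_zeta hadmm).
have E v : `|rho *: (A (x k.+1) - B v - c) + rho^-1 *: lambda k|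
  = `|rho *: B v - (rho *: A (x k.+1) + rho^-1 *: lambda k - rho *: c)|.
  rewrite -normrN; congr `|_|; rewrite !scalerBr !opprD !opprK.
  by rewrite -!addrA addrCA; congr (_ + (_ + _)); rewrite addrC.
by rewrite !E.
Qed.

Lemma admm_subgradient_x k :
  subgradient_along f A (rho *: (p k - l k - a k)) (x k.+1).
Proof.
have [fc _ fp] := hf; apply: argmin_subgradient => // u.
have := admm_x hadmm k u.
have E v : `|rho *: (A v - B (z k) - c) + rho^-1 *: lambda k|
  = `|rho *: A v - (p k - l k)|.
  by congr `|_|; rewrite /p /l -addrA -opprD scalerBr opprD opprK addrA.
by rewrite !E.
Qed.

(** Iterations [k] and [k.+1] serve as the two runs of [douglas_rachford_step]. *)
Lemma admm_step_consecutive k :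
  [/\ `|zeta k.+2 - zeta k.+1| ^+ 2 <= `|zeta k.+1 - zeta k| ^+ 2,
      `|A (x k.+2) - A (x k.+1)| ^+ 2
        <= rho^-1 ^+ 2 * `|zeta k.+1 - zeta k| ^+ 2
    & `|lambda k.+1 - lambda k| ^+ 2
        <= rho ^+ 2 * `|zeta k.+1 - zeta k| ^+ 2].
Proof.
have zE j : zeta j.+1 = a j + l j by rewrite (admm_zeta hadmm).
have lE j : lambda j = rho *: l j by rewrite /l scalerA mulfV// scale1r.
have Ha : 0 <= inner (p k.+1 - p k - (l k.+1 - l k) - (a k.+1 - a k))
    (a k.+1 - a k).
  have := subgradient_monotone _ _ _ _ _ _
    (admm_subgradient_x k.+1) (admm_subgradient_x k).
  rewrite -scalerBr innerZl -innerZr scalerBr -/(a _) -/(a _).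
  by rewrite !innerE; lra.
have Hl : 0 <= inner (l k.+1 - l k) (p k.+1 - p k).
  have := subgradient_monotone _ _ _ _ _ _
    (admm_subgradient_z k.+1) (admm_subgradient_z k).
  rewrite !lE -scalerBr innerZl -innerZr scalerBr /p.
  by rewrite !scalerDr !innerE; lra.
have [] := douglas_rachford_step _ _ _ Ha Hl.
have -> : p k.+1 - p k + (l k.+1 - l k) = zeta k.+1 - zeta k.
  by rewrite !admm_zetaE opprD addrACA.
have -> : a k.+1 - a k + (l k.+1 - l k) = zeta k.+2 - zeta k.+1.
  by rewrite !zE opprD addrACA.
move=> h1 h2 h3; split.
- by apply: le_trans h1; rewrite lerDl exprn_ge0.
- rewrite -[A (x k.+2) - _]scale1r -(mulVf rho0) -scalerA normrZ exprMn.
  rewrite scalerBr -/(a _) -/(a _) real_normK ?num_real//.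
  by rewrite ler_wpM2l// sqr_ge0.
- by rewrite !lE -scalerBr normrZ exprMn real_normK ?num_real// ler_wpM2l// sqr_ge0.
Qed.

Lemma admm_step_fixpoint k (zetas := rho *: A xs + rho^-1 *: ls) :
  `|zeta k.+1 - zetas| ^+ 2 + `|zeta k.+1 - zeta k| ^+ 2
    <= `|zeta k - zetas| ^+ 2.
Proof.
have [_ _ fp] := hf; have [_ _ gp] := hg.
have [sf sg] := saddle_subgradients fp gp hsaddle.
have zE : zeta k.+1 = a k + l k by rewrite (admm_zeta hadmm).
have lE : lambda k = rho *: l k by rewrite /l scalerA mulfV// scale1r.
have lsE : ls = rho *: (rho^-1 *: ls) by rewrite scalerA mulfV// scale1r.
(* Feasibility makes [p] and [a] coincide at the solution, so the second run is stationary at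
   [zetas]. *)
have pE : rho *: A xs = rho *: B zs + rho *: c.
  by rewrite -scalerDr; congr (_ *: _); case: hopt => <- _; rewrite addrC subrK.
have Ha : 0 <= inner (p k - rho *: A xs - (l k - rho^-1 *: ls)
    - (a k - rho *: A xs)) (a k - rho *: A xs).
  have := subgradient_monotone _ _ _ _ _ _ (admm_subgradient_x k) sf.
  rewrite {1}lsE -[- (rho *: (rho^-1 *: ls))]scalerN -scalerBr innerZl -innerZr scalerBr -/(a _).
  by rewrite !innerE; lra.
have Hl : 0 <= inner (l k - rho^-1 *: ls) (p k - rho *: A xs).
  have := subgradient_monotone _ _ _ _ _ _ (admm_subgradient_z k) sg.
  rewrite lE {1}lsE -scalerBr innerZl -innerZr scalerBr pE /p.
  by rewrite !scalerDr !innerE; lra.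
have [+ _ _] := douglas_rachford_step _ _ _ Ha Hl.
have -> : a k - rho *: A xs + (l k - rho^-1 *: ls) = zeta k.+1 - zetas.
  by rewrite zE opprD addrACA.
have -> : p k - rho *: A xs + (l k - rho^-1 *: ls) = zeta k - zetas.
  by rewrite admm_zetaE opprD addrACA.
suff -> : a k - rho *: A xs - (p k - rho *: A xs) = zeta k.+1 - zeta k by [].
by rewrite zE admm_zetaE !opprD opprK addrACA addNr addr0 addrACA subrr addr0.
Qed.

Lemma admm_rate k (D := `|zeta0 - (rho *: A xs + rho^-1 *: ls)| ^+ 2) :
  [/\ `|zeta k.+1 - zeta k| ^+ 2 <= 1 / k.+1%:R * D,
      `|A (x k.+2) - A (x k.+1)| ^+ 2 <= 1 / k.+1%:R * (rho^-1 ^+ 2 * D)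
    & `|lambda k.+1 - lambda k| ^+ 2 <= 1 / k.+1%:R * (rho ^+ 2 * D)].
Proof.
have Hz : `|zeta k.+1 - zeta k| ^+ 2 <= 1 / k.+1%:R * D.
  rewrite /D -(admm_zeta_init hadmm).
  apply: (telescoped_rate (fun j => `|zeta j - (rho *: A xs + rho^-1 *: ls)| ^+ 2)
    (fun j => `|zeta j.+1 - zeta j| ^+ 2)) => j.
  - exact: exprn_ge0.
  - exact: admm_step_fixpoint.
  - by have [] := admm_step_consecutive j.
have [_ Hx Hl] := admm_step_consecutive k.
by split=> //; rewrite mulrCA; [apply: le_trans Hx _ | apply: le_trans Hl _];
  rewrite ler_wpM2l// sqr_ge0.
Qed.

End ADMM.

Theorem proposition4p4 (R : realType) (H P K : hilbertType R)
    (f : H -> \bar R) (g : P -> \bar R)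
    (A : {linear H -> K}) (B : {linear P -> K}) (c : K)
    (xs : H) (zs : P) (ls : K)
    (hf : Gamma0 f) (hg : Gamma0 g)
    (A_bounded : bounded_near A (nbhs (0 : H))) (A_inj : injective A)
    (B_bounded : bounded_near B (nbhs (0 : P))) (B_inj : injective B)
    (hopt : is_optimal f g A B c xs zs)
    (hsaddle : is_saddle_point f g A B c xs zs ls) :
  (`|A xs| != 0 -> `|ls| = 0 ->
   forall zeta0 : K, zeta0 != 0 ->
   let omega1 := angle (A xs) zeta0 in
   cos omega1 != 0 ->
   let rho := `|zeta0| / `|A xs| * (1 / cos omega1) in
   forall (x : nat -> H) (z : nat -> P) (lambda zeta : nat -> K),
   admm_iterates f g A B c rho zeta0 x z lambda zeta ->
   forall k : nat,
   [/\ `|A (x k.+2) - A (x k.+1)| ^+ 2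
         <= 1 / k.+1%:R * (`|A xs| ^+ 2 * sin omega1 ^+ 2),
       `|lambda k.+1 - lambda k| ^+ 2
         <= 1 / k.+1%:R * (`|zeta0| ^+ 4 / `|A xs| ^+ 2)
            * (tan omega1 ^+ 2 / cos omega1 ^+ 2)
     & `|zeta k.+1 - zeta k| ^+ 2
         <= 1 / k.+1%:R * (`|zeta0| ^+ 2 * tan omega1 ^+ 2)]) /\
  (`|A xs| = 0 -> `|ls| != 0 ->
   forall zeta0 : K, zeta0 != 0 ->
   let omega2 := angle ls zeta0 in
   cos omega2 != 0 ->
   let rho := 1 / (`|zeta0| / `|ls| * (1 / cos omega2)) in
   forall (x : nat -> H) (z : nat -> P) (lambda zeta : nat -> K),
   admm_iterates f g A B c rho zeta0 x z lambda zeta ->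
   forall k : nat,
   [/\ `|lambda k.+1 - lambda k| ^+ 2
         <= 1 / k.+1%:R * (`|ls| ^+ 2 * sin omega2 ^+ 2),
       `|A (x k.+2) - A (x k.+1)| ^+ 2
         <= 1 / k.+1%:R * (`|zeta0| ^+ 4 / `|ls| ^+ 2)
            * (tan omega2 ^+ 2 / cos omega2 ^+ 2)
     & `|zeta k.+1 - zeta k| ^+ 2
         <= 1 / k.+1%:R * (`|zeta0| ^+ 2 * tan omega2 ^+ 2)]).

Proof.
(* Here [n = |zeta0|], [a] is [|A xs|] or [|ls|], and [s / C] is the tangent. [Einv] and [Emul]
   evaluate the two scaled bounds of [admm_rate]. *)
have Einv (n a s C : R) : n != 0 -> a != 0 -> C != 0 ->
    (n / a * (1 / C))^-1 ^+ 2 * (n ^+ 2 * (s / C) ^+ 2) = a ^+ 2 * s ^+ 2.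
  by move=> n0 a0 C0; field; rewrite n0 a0 C0.
have Emul (n a s C : R) : a != 0 -> C != 0 ->
    (n / a * (1 / C)) ^+ 2 * (n ^+ 2 * (s / C) ^+ 2)
    = n ^+ 4 / a ^+ 2 * ((s / C) ^+ 2 / C ^+ 2).
  by move=> a0 C0; field; rewrite a0 C0.
have r0 (n a C : R) : n != 0 -> a != 0 -> C != 0 -> n / a * (1 / C) != 0.
  by move=> n0 a0 C0; rewrite !mulf_neq0 ?invr_neq0 ?oner_neq0.
split=> [Axs0 ls0|Axs0 ls0] zeta0 z0 om c0 rho x z lambda zeta ha k.
- have nz : `|zeta0| != 0 by rewrite normr_eq0.
  have Axs_neq0 : A xs != 0 by rewrite -normr_eq0.
  have rho0 : rho != 0 := r0 _ _ _ nz Axs0 c0.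
  have D : `|zeta0 - (rho *: A xs + rho^-1 *: ls)| ^+ 2
      = `|zeta0| ^+ 2 * tan om ^+ 2.
    by rewrite (normr0_eq0 ls0) scaler0 addr0; exact: sqrnormB_angle.
  have := admm_rate _ _ _ _ _ _ _ _ _ _ _ _ _ _ hf hg rho0 hopt hsaddle ha k.
  rewrite D => -[Hz Hx Hl]; split=> //.
  + by rewrite -(Einv _ _ _ _ nz Axs0 c0).
  + by rewrite -mulrA -(Emul _ _ _ _ Axs0 c0).
- have nz : `|zeta0| != 0 by rewrite normr_eq0.
  have ls_neq0 : ls != 0 by rewrite -normr_eq0.
  (* The dual step-size is the inverse of the primal formula, so [Einv] and [Emul] exchange roles
     between [A x] and [lambda]. *)
  have rhoV : rho^-1 = `|zeta0| / `|ls| * (1 / cos om) by rewrite /rho div1r invrK.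
  have rho0 : rho != 0 by rewrite -invr_eq0 rhoV; exact: r0.
  have D : `|zeta0 - (rho *: A xs + rho^-1 *: ls)| ^+ 2
      = `|zeta0| ^+ 2 * tan om ^+ 2.
    by rewrite (normr0_eq0 Axs0) scaler0 add0r rhoV; exact: sqrnormB_angle.
  have := admm_rate _ _ _ _ _ _ _ _ _ _ _ _ _ _ hf hg rho0 hopt hsaddle ha k.
  rewrite D => -[Hz Hx Hl]; split=> //.
  + by rewrite -(Einv _ _ _ _ nz ls0 c0) -rhoV invrK.
  + by rewrite -mulrA -(Emul _ _ _ _ ls0 c0) -rhoV.
Qed.
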